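(* For the Tanaka-Ito family $(T_\alpha)_{\alpha\in[0,1]}$, matching holds almost everywhere on $[0,1]$, i.e. the matching set has full Lebesgue measure in $[0,1]$, and the only possible matching indices are $-2,0,2$. More precisely, if $\alpha\le\frac12$ belongs to a matching interval, then the matching index of this interval is $0$ or $2$; and if $\alpha\ge\frac12$ belongs to a matching interval, then the matching index of this interval is $0$ or $-2$.
   Context: For $\alpha\in[0,1]$ the Tanaka-Ito map $T_\alpha:[\alpha-1,\alpha]\to[\alpha-1,\alpha]$ is defined by $T_\alpha(0)=0$ and $T_\alpha(x)=\frac1x-\left\lfloor\frac1x+1-\alpha\right\rfloor$ for $x\ne0$; $T_\alpha^n$ is its $n$-th iterate, $T_\alpha^0$ the identity. A non-empty open interval $J\subset[0,1]$ is a matching interval with matching exponents $M,N$ (positive integers) if $T_\alpha^M(\alpha-1)=T_\alpha^N(\alpha)$ for all $\alpha\in J$, $T_\alpha^{M-1}(\alpha-1)\ne T_\alpha^{N-1}(\alpha)$ for Lebesgue-almost all $\alpha\in J$, and $J$ is not contained in a larger open interval with these properties (for the same $M,N$). The matching index of $J$ is $\Delta=M-N$. The matching set is the union of all matching intervals. *)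

(* Defs.v *)
From mathcomp Require Import all_boot all_order all_algebra.
From mathcomp Require Import all_classical all_reals all_analysis.
From mathcomp Require Import lra.
Set Implicit Arguments.
Unset Strict Implicit.
Unset Printing Implicit Defensive.
Import Order.TTheory GRing.Theory Num.Theory.
Import numFieldNormedType.Exports.
Local Open Scope classical_set_scope.
Local Open Scope ring_scope.

(* T_alpha is given as a total function on R; only its restriction to
   [alpha - 1, alpha] is meant, and tanaka_ito_itv shows that it maps into
   that interval. *)
Definition tanaka_ito (R : realType) (alpha x : R) : R :=
  if x == 0 then 0
  else x^-1 - (Num.floor (x^-1 + 1 - alpha))%:~R.

Lemma tanaka_ito_itv (R : realType) (alpha x : R) :
  0 <= alpha <= 1 -> alpha - 1 <= tanaka_ito alpha x <= alpha.
Proof.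
move=> /andP[a0 a1]; rewrite /tanaka_ito; case: ifP => _; first by lra.
have h1 := floor_le (x^-1 + 1 - alpha).
have := floorD1_gt (x^-1 + 1 - alpha); rewrite intrD => h2.
by lra.
Qed.

(* The defining properties of a matching interval, apart from maximality. *)
Definition matching_on (R : realType) (M N : nat) (J : set R) : Prop :=
  [/\ J !=set0, open J, is_interval J & J `<=` `[0, 1]] /\
  [/\ (0 < M)%N, (0 < N)%N,
      forall alpha, J alpha ->
        iter M (tanaka_ito alpha) (alpha - 1) = iter N (tanaka_ito alpha) alpha
    & {ae (@lebesgue_measure R), forall alpha, J alpha ->
        iter M.-1 (tanaka_ito alpha) (alpha - 1)
          <> iter N.-1 (tanaka_ito alpha) alpha}].

Definition matching_interval (R : realType) (M N : nat) (J : set R) : Prop :=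
  matching_on M N J /\
  forall J' : set R, matching_on M N J' -> J `<=` J' -> J' = J.

Definition matching_index (M N : nat) : int := M%:Z - N%:Z.

Definition matching_set (R : realType) : set R :=
  [set alpha | exists M N (J : set R), matching_interval M N J /\ J alpha].

(* Main.v *)
Require Import Defs.
From mathcomp Require Import all_boot all_order all_algebra.
From mathcomp Require Import all_classical all_reals all_analysis.
From mathcomp Require Import measurable_realfun.
From mathcomp Require Import ring lra zify.
Set Implicit Arguments.
Unset Strict Implicit.
Unset Printing Implicit Defensive.
Import Order.TTheory GRing.Theory Num.Theory.
Import numFieldNormedType.Exports.
Local Open Scope classical_set_scope.
Local Open Scope ring_scope.
(** Write [x_i], [y_i] for the orbits of [a - 1] and [a] under [T_a], with
    [0 < a < 1/2]; the case [a > 1/2] follows from the symmetry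
    [(a, x) -> (1 - a, -x)].  Off a countable set of parameters all digits are
    locally constant, so [x_i] and [y_i] are locally Moebius functions of [a].

    If [a^2 - 3 a + 1 < 0], the two orbits merge after two or three steps each.
    Otherwise [x_2 + y_1] is [0] or [-1], and from then on the pair satisfies
    [x_{j+1} + y_j = 0] or [-1] until either [y_j <= -1/(2-a)], which yields a
    matching of index 0, or [x_{j+1} <= -1/(2-a)], which yields index 2.  Hence
    without matching the whole orbit [y_n] stays above [-1/(2-a)].  Modulo sign
    and integers that orbit runs through the Gauss orbit of [a], skipping at
    most one point at a time, and a visit of the Gauss orbit close enough to
    the golden mean [g] pushes [y_n] out of [(-1/(2-a), a]].  The parameters
    whose Gauss orbit avoids a neighbourhood of [g] form a porous set, which is
    null by the Lebesgue density theorem.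

    The index is independent of the exponents [M], [N]: two parameters with
    equal digits repel each other under [T], since [|1/x - 1/y| > |x - y|] in
    [(-1, 1)], so [y_m = y_n] with [m <> n] cannot hold at both of them; by
    countability of digit strings any two matchings on an open set of
    parameters have the same index. *)

(** * Sets avoided by the Gauss map *)

(** An open interval that misses [F] misses [closure F] too, so at each point of [F] the closure has
    density at most [1 - c/2] at arbitrarily small radii. The Lebesgue density theorem allows this
    only on a null set. *)
Lemma porous_negligible (R : realType) (F : set R) :
  (forall x, F x -> exists2 c : R, 0 < c & forall e, 0 < e -> exists r a b : R,
    [/\ 0 < r < e, c * r <= b - a, `]a, b[ `<=` ball x r
      & F `&` `]a, b[ = set0]) ->
  (@lebesgue_measure R).-negligible F.
Proof.
move=> Fporous; have mF : measurable (closure F).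
  apply: closed_measurable; exact: closed_closure.
apply: negligibleS (lebesgue_density mF) => x Fx /= dens.
have [c c0 {}Fporous] := Fporous x Fx; move: dens.
rewrite indicE mem_set ?mulr1n; last exact: subset_closure.
set f := (X in X @ _ --> _) => cf.
(* Any threshold strictly between [1 - c/2] and the limit [1] leads to the contradiction. *)
have : \forall r \near 0^'+, ((1 - c / 4)%:E < f r)%E.
  apply: (cf [set y | ((1 - c / 4)%:E < y)%E]); apply: open_nbhs_nbhs.
  split; first exact: open_ereal_gt_ereal.
  by rewrite /= lte_fin; lra.
move=> -[e /= e0 near_f].
have [r [a [b [/andP[r0 re] crab abr Fab]]]] := Fporous e e0.
have := near_f r; rewrite /= sub0r normrN gtr0_norm// => /(_ re r0).
rewrite /f {f cf near_f}.
have cFab : closure F `&` `]a, b[ = set0.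
  rewrite -subset0 => y [cFy aby].
  have [z [Fz abz]] : F `&` `]a, b[ !=set0.
    by apply: cFy; apply: open_nbhs_nbhs; split => //; exact: interval_open.
  by have := conj Fz abz; rewrite -[_ /\ _]/((F `&` _) z) Fab.
have r0' := ltW r0; rewrite lebesgue_measure_ball//.
set m := lebesgue_measure _ => mlt.
have : (m <= (r *+ 2)%:E - (b - a)%:E)%E.
  have ab : a < b by have := mulr_gt0 c0 r0; lra.
  have -> : ((r *+ 2)%:E - (b - a)%:E =
     lebesgue_measure (ball x r `\` `]a, b[))%E.
    rewrite measureD//=; last 2 first.
      exact: measurable_ball.
      by rewrite lebesgue_measure_ball// ltry.
    rewrite lebesgue_measure_ball// setIC (setIidl _)//.
    by rewrite lebesgue_measure_itv/= lte_fin ab.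
  rewrite /m le_measure ?inE//=.
  - by apply: measurableI => //; exact: measurable_ball.
  - by apply: measurableD => //; exact: measurable_ball.
  - move=> y [cFy xy]; split=> // aby.
    by have := conj cFy aby; rewrite -[_ /\ _]/((closure F `&` _) y) cFab.
move: mlt; rewrite inver; case: ifPn => [|_].
  by move=> /eqP; rewrite mulr2n => ?; exfalso; lra.
have m0 : (0 <= m)%E by exact: measure_ge0.
move: m m0 => [m| |]//= m0; rewrite -EFinM -EFinB !lte_fin lee_fin.
rewrite mulr2n ltr_pdivlMr; last lra.
nra.
Qed.

(** Since [0^-1 = 0], the point [0] is fixed: an orbit that reaches [0] stays there. *)
Definition gauss_map (R : realType) (x : R) : R :=
  x^-1 - (Num.floor x^-1)%:~R.

Lemma gauss_map_itv (R : realType) (x : R) : 0 <= gauss_map x < 1.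
Proof.
rewrite /gauss_map; have := floor_le x^-1.
by have := floorD1_gt x^-1; rewrite intrD; lra.
Qed.

Lemma gauss_map_invD (R : realType) (a : int) (t : R) :
  0 <= t < 1 -> gauss_map (a%:~R + t)^-1 = t.
Proof.
move=> t01; rewrite /gauss_map invrK (@floor_def _ _ a); first by ring.
by rewrite intrD; lra.
Qed.

Lemma gauss_map_eq (R : realType) (x t : R) (a : int) :
  x^-1 = a%:~R + t -> 0 <= t < 1 -> gauss_map x = t.
Proof. by move=> xE t01; rewrite -(gauss_map_invD a t01) -xE invrK. Qed.

Lemma iter_gauss_gt0 (R : realType) (x : R) (n : nat) :
  0 < x < 1 -> iter n (@gauss_map R) x != 0 ->
  0 < iter n (@gauss_map R) x < 1.
Proof.
move=> x01; case: n => [//|n]; rewrite iterS => xn0.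
by have /andP[ge0 ->] := gauss_map_itv (iter n (@gauss_map R) x);
  rewrite lt0r xn0 ge0.
Qed.

(** [h] is the inverse branch of the n-th Gauss iterate through [x]; [p/q] and [p'/q'] are
    consecutive convergents, the latter being the earlier one. The bound [q' <= q] controls the
    distortion of [h], and the growth of [q + q'] makes the cylinders shrink. *)
Lemma gauss_branch (R : realType) (x : R) (n : nat) :
  0 < x < 1 -> (forall i, iter i (@gauss_map R) x != 0) ->
  exists p p' q q' : R, let h t := (p + t * p') / (q + t * q') in
    [/\ [/\ 0 <= q', q' <= q, 1 <= q & n.+1%:R <= q + q'], `|p' * q - p * q'| = 1,
        x = h (iter n (@gauss_map R) x)
      & forall t, 0 < t < 1 -> 0 < h t < 1 /\ iter n (@gauss_map R) (h t) = t].
Proof.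
move=> x01 xn0; elim: n => [|n [p [p' [q [q' /= [[q'0 q'q q1 nq] det xh hP]]]]]].
  exists 0, 1, 1, 0 => /=; split.
  - by split; rewrite ?ler01 ?addr0 ?lexx.
  - by rewrite mulr1 mul0r subr0 normr1.
  - by field.
  - by move=> t t01; rewrite (_ : _ / _ = t)//; field.
have n0 : 1 <= n.+1%:R :> R by rewrite ler1n.
have q_gt0 : 0 < q by lra.
have := iter_gauss_gt0 x01 (xn0 n); have := iter_gauss_gt0 x01 (xn0 n.+1).
rewrite iterS; move: (iter n _ x) xh => y xh.
pose a := Num.floor y^-1 => y'01 y01.
have y1 : 1 < y^-1 by rewrite invf_gt1; lra.
have a1 : 1 <= a%:~R :> R.
  by rewrite (_ : 1 = 1%:~R)// ler_int -gtz0_ge1 floor_gt0 ltW.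
(* The next branch is the old one composed with [t |-> 1 / (a + t)], where [a] is the next digit. *)
have hE (t : R) : 0 < t -> (p * a%:~R + p' + t * p) / (q * a%:~R + q' + t * q) =
    (p + (a%:~R + t)^-1 * p') / (q + (a%:~R + t)^-1 * q').
  move=> t0; field; apply/andP; split; apply: lt0r_neq0; nra.
exists (p * a%:~R + p'), p, (q * a%:~R + q'), q; split=> /=.
- have qa : q <= q * a%:~R by rewrite ler_peMr// ltW.
  by split; [lra|lra|lra|rewrite -natr1; lra].
- by rewrite -det distrC; congr `|_|; ring.
- rewrite hE; last lra.
  by rewrite (_ : a%:~R + gauss_map y = y^-1) ?invrK// /gauss_map -/a; ring.
- move=> t t01; rewrite hE; last lra.
  have at01 : 0 < (a%:~R + t)^-1 < 1.
    by rewrite invr_gt0 invf_lt1; lra.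
  have [h01 hn] := hP _ at01; split => //.
  by rewrite hn gauss_map_invD//; lra.
Qed.

(** Porosity: [h] carries [(w1, w2)] to a gap, as the n-th iterate of its points lies in the window.
    By [|h s - h t| = |s - t| / ((q + s q') (q + t q'))], the gap has length at least
    [(w2 - w1) / (4 q^2)] and stays within [1 / q^2] of [x]. *)
Lemma gauss_avoid_negligible (R : realType) (m0 : nat) (w1 w2 : R) :
  0 <= w1 < w2 -> w2 <= 1 ->
  (@lebesgue_measure R).-negligible [set x | [/\ 0 < x < 1,
    (forall i, iter i (@gauss_map R) x != 0) &
    forall m, (m0 <= m)%N -> ~ (w1 < iter m (@gauss_map R) x < w2)]].
Proof.
move=> w12 w21; apply: porous_negligible => x [x01 xn0 xavoid].
exists ((w2 - w1) / 4) => [|e e0]; first lra.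
(* Here [n >= m0] makes the n-th iterate count, and [n > 4 / e] gives [q > 2 / e], so that the
   radius [1 / q^2] is below [e]. *)
pose n := (maxn m0 (Num.truncn (4 / e)).+1).
have [p [p' [q [q']]]] := gauss_branch n x01 xn0.
set h := (fun t => _) => -[[q'0 q'q q1 nq] det xh hP].
have n0 : 1 <= n.+1%:R :> R by rewrite ler1n.
have q_gt0 : 0 < q by lra.
have ne : 4 / e < n%:R.
  apply: lt_le_trans (truncnS_gt _) _.
  by rewrite ler_nat leq_maxr.
have den t : 0 <= t -> 0 < q + t * q' by move=> t0; nra.
have hB s t : 0 <= s -> 0 <= t ->
    `|h s - h t| = `|s - t| / ((q + s * q') * (q + t * q')).
  move=> s0 t0; have qs := den s s0; have qt := den t t0.
  rewrite /h (_ : _ - _ = (p' * q - p * q') * (s - t) /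
     ((q + s * q') * (q + t * q'))); last by field; rewrite !lt0r_neq0.
  by rewrite !normrM det mul1r normfV (gtr0_norm (mulr_gt0 qs qt)).
have q2 : 0 < q ^+ 2 by rewrite exprn_gt0.
have hw : (w2 - w1) / 4 / q ^+ 2 <= `|h w1 - h w2|.
  rewrite hB; [|lra..]; rewrite ltr0_norm; last lra.
  rewrite -[- _ / _]mulr1 opprB -!mulrA ler_pM2l; last lra.
  rewrite -invfM mulr1 lef_pV2 ?posrE ?mulr_gt0 ?den//; [|lra..].
  have b1 : q + w1 * q' <= 2 * q by nra.
  have b2 : q + w2 * q' <= 2 * q by nra.
  have := ler_pM (ltW (den w1 _)) (ltW (den w2 _)) b1 b2; lra.
have xn01 := iter_gauss_gt0 x01 (xn0 n).
(* [h] may reverse the orientation, hence the minimum and the maximum. *)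
exists (q ^+ 2)^-1, (Num.min (h w1) (h w2)), (Num.max (h w1) (h w2)).
have hitv z : z \in `](Num.min (h w1) (h w2)), (Num.max (h w1) (h w2))[ ->
    exists2 t, w1 < t < w2 & h t = z.
  rewrite in_itv/= => zh.
  have [|||t] := @IVT R h w1 w2 z.
  - lra.
  - apply: continuous_in_subspaceT => t /set_mem; rewrite /= in_itv/= => tw.
    apply: cvgM; last apply: cvgV.
    + by apply: cvgD; [exact: cvg_cst|apply: cvgM; [exact: cvg_id|exact: cvg_cst]].
    + by apply: lt0r_neq0; apply: den; lra.
    + by apply: cvgD; [exact: cvg_cst|apply: cvgM; [exact: cvg_id|exact: cvg_cst]].
  - by case/andP: zh => /ltW -> /ltW ->.
  rewrite in_itv/= => tw tz; exists t => //.
  suff: t != w1 /\ t != w2 by case=> /eqP ? /eqP ?; lra.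
  split; apply/eqP => tE; move: zh; rewrite -tz tE.
    by rewrite gt_min lt_max ltxx/=; move: (h w1) (h w2) => ? ?; lra.
  by rewrite gt_min lt_max ltxx orbF; move: (h w1) (h w2) => ? ?; lra.
split.
- rewrite invr_gt0 q2/= invf_plt ?posrE//.
  have qn : n%:R / 2 < q.
    by move: nq; rewrite -natr1; lra.
  have e1 : e^-1 * 2 < q by move: ne; lra.
  have ei : 0 < e^-1 by rewrite invr_gt0.
  have qq : 1 <= q by lra.
  nra.
- apply: le_trans hw _; have [h12|h12] := leP (h w1) (h w2).
    by rewrite ler0_norm; lra.
  by rewrite gtr0_norm; lra.
- move=> z /hitv[t tw <-]; rewrite {1}xh /ball/=.
  rewrite hB; [|lra..].
  have qt := den t; have qs := den (iter n (@gauss_map R) x).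
  rewrite ltr_pdivrMr ?mulr_gt0 ?qt ?qs; [|lra..].
  rewrite mulrC ltr_pdivlMr//.
  have : `|iter n (@gauss_map R) x - t| < 1 by rewrite ltr_norml; lra.
  move: (iter n _ x) xn01 {xh} => y y01 yt.
  have y0 : 0 <= `|y - t| by [].
  have t0 : 0 < t by lra.
  have : q ^+ 2 <= (q + y * q') * (q + t * q').
    by rewrite expr2 ler_pM//; nra.
  nra.
- rewrite -subset0 => z [[z01 zn0 zavoid] /hitv[t tw tz]].
  have t01 : 0 < t < 1 by lra.
  have [_ hn] := hP _ t01; apply: (zavoid n); first exact: leq_maxl.
  by rewrite -tz hn.
Qed.

(** * Orbits and digits *)

(* The two orbits to compare start at [a - c] with [c = 1] and [c = 0]. *)
Definition orb (R : realType) (c : R) (n : nat) (a : R) : R :=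
  iter n (tanaka_ito a) (a - c).

Definition dig (R : realType) (c : R) (n : nat) (a : R) : int :=
  Num.floor ((orb c n a)^-1 + 1 - a).

Lemma orbS (R : realType) (c : R) (n : nat) (a : R) :
  orb c n a != 0 -> orb c n.+1 a = (orb c n a)^-1 - (dig c n a)%:~R.
Proof.
move=> /negPf n0; rewrite {1}/orb iterS -/(orb c n a) /dig.
by rewrite /tanaka_ito n0.
Qed.

Lemma orb_itv (R : realType) (c : R) (n : nat) (a : R) :
  0 <= c <= 1 -> 0 <= a <= 1 -> a - 1 <= orb c n a <= a.
Proof.
move=> c01 a01; case: n => [|n]; first by rewrite /orb/=; lra.
by rewrite /orb iterS; exact: tanaka_ito_itv.
Qed.

Lemma orb_norm_lt1 (R : realType) (c : R) (n : nat) (a : R) :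
  0 <= c <= 1 -> 0 < a < 1 -> `|orb c n a| < 1.
Proof.
move=> c01 a01; have := @orb_itv R c n a c01; rewrite ltr_norml; lra.
Qed.

(** Equal digits cancel in the difference, so one step from [x], [y] multiplies the distance by
    [1 / |x y| > 1]. *)
Lemma orb_lt_dist (R : realType) (c : R) (m n : nat) (a b : R) :
  0 <= c <= 1 -> 0 < a < 1 -> 0 < b < 1 -> a != b ->
  (forall i, (i < n)%N ->
     [/\ orb c i a != 0, orb c i b != 0 & dig c i a = dig c i b]) ->
  (m < n)%N -> `|orb c m a - orb c m b| < `|orb c n a - orb c n b|.
Proof.
move=> c01 a01 b01 ab same mn.
have step i : (i < n)%N -> 0 < `|orb c i a - orb c i b| ->
    `|orb c i a - orb c i b| < `|orb c i.+1 a - orb c i.+1 b|.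
  move=> /same[a0 b0 ed] dpos; rewrite !orbS// ed.
  have -> : (orb c i a)^-1 - (dig c i b)%:~R -
      ((orb c i b)^-1 - (dig c i b)%:~R) =
      - ((orb c i a - orb c i b) / (orb c i a * orb c i b)).
    by field; apply/andP.
  rewrite normrN normrM normfV ltr_pdivlMr ?normr_gt0 ?mulf_neq0//.
  by rewrite gtr_pMr// normrM mulr_ilt1 ?orb_norm_lt1.
have pos i : (i <= n)%N -> 0 < `|orb c i a - orb c i b|.
  elim: i => [_|i IH ilt]; last first.
    by have di := IH (ltnW ilt); exact: lt_trans di (step _ ilt di).
  by rewrite /orb/= normr_gt0 (_ : _ - _ = a - b) ?subr_eq0//; ring.
elim: n mn step pos {same} => [//|n IH] mn step pos.
have := step n (ltnSn _) (pos _ (leqnSn _)).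
have [->//|mltn] := eqVneq m n; apply: lt_trans; apply: IH.
- by rewrite ltn_neqAle mltn -ltnS.
- by move=> i ilt; apply: step; exact: ltnW.
- by move=> i ilt; apply: pos; exact: leqW.
Qed.

(** From a nonzero point, the value [a - 1] is taken exactly at the discontinuities of [T_a]. So a
    regular orbit meets neither [0] nor a jump of the digit. *)
Definition orb_regular (R : realType) (c a : R) : Prop :=
  forall n, orb c n a != 0 /\ orb c n.+1 a != a - 1.

Lemma countable_dig_inj (R : realType) (c : R) (n : nat) (A : set R) :
  {in A &, forall a b,
     mkseq (fun i => dig c i a) n = mkseq (fun i => dig c i b) n -> a = b} ->
  countable A.
Proof.
move=> inj; apply/countable_injP.
exists (fun a => choice.pickle (mkseq (fun i => dig c i a) n)).
move=> a b aA bA /(pcan_inj (@choice.pickleK _)); exact: inj.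
Qed.

(** Two parameters [a], [b] that reach [0], or that reach the left endpoint, at the same time and
    with equal digits before would then be at distance [0] or [|a - b|], against expansion. So
    finite digit strings separate them. The orbit of the parameter [c] itself starts at [0]. *)
Lemma countable_orb_irregular (R : realType) (c : R) :
  0 <= c <= 1 ->
  countable [set a | [/\ 0 < a < 1, a != c & ~ orb_regular c a]].
Proof.
move=> c01.
pose S (t : bool) n : set R := [set a | [/\ 0 < a < 1,
  (forall i, (i < n.+1)%N -> orb c i a != 0)
  & orb c n.+1 a = if t then a - 1 else 0]].
apply: (@sub_countable _ _ _ (\bigcup_(k in [set: nat * bool]) S k.2 k.1)).
  apply: subset_card_le => a [a01 ac]; apply: contra_notP => aS n.
  have a0 i : orb c i a != 0.
    have [k] := ubnP i; elim: k i => // k IH [_|i ik].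
      by rewrite /orb/= subr_eq0.
    apply/eqP => ai; apply: aS; exists (i, false) => //; split => // j ji.
    by apply: IH; exact: leq_trans ji ik.
  split=> //; apply/eqP => an; apply: aS; by exists (n, true).
apply: (@bigcup_countable _ _ setT (fun k => S k.2 k.1)) => [|[n t] _ /=].
  exact: countableP.
apply: (@countable_dig_inj _ c n.+1) => a b /set_mem[a01 an0 an].
move=> /set_mem[b01 bn0 bn] ed; apply/eqP/negPn/negP => ab.
have : `|orb c 0 a - orb c 0 b| < `|orb c n.+1 a - orb c n.+1 b|.
  apply: orb_lt_dist => // i ilt; split; [exact: an0|exact: bn0|].
  have := congr1 (fun s => nth 0 s i) ed; by rewrite !nth_mkseq.
rewrite an bn /orb/=; case: t {an bn} => /=.
  by rewrite (_ : a - c - _ = a - 1 - (b - 1)) ?ltxx//; ring.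
by rewrite subrr normr0 ltNge normr_ge0.
Qed.

Lemma floor_near (R : realType) (f : R -> R) (a : R) :
  {for a, continuous f} -> f a != (Num.floor (f a))%:~R ->
  \forall b \near a, (Num.floor (f a))%:~R < f b < (Num.floor (f a))%:~R + 1.
Proof.
move=> fa fai; apply: (fa [set y | _ < y < _]); apply: open_nbhs_nbhs.
split; first exact: (@interval_open _ (BRight _) (BLeft _)).
have := floorD1_gt (f a); have := floor_le (f a); rewrite /= intrD => fle ->.
by rewrite lt_neqAle eq_sym fai fle.
Qed.

(** Regularity keeps the argument of the floor off the integers. So continuity of one iterate makes
    its digit locally constant, and this gives continuity of the next iterate. *)
Lemma orb_local (R : realType) (c a : R) (n : nat) :
  orb_regular c a ->
  {for a, continuous (orb c n)} /\
  \forall b \near a, [/\ orb c n b != 0,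
    orb c n.+1 b = (orb c n b)^-1 - (dig c n a)%:~R & b - 1 < orb c n.+1 b < b].
Proof.
move=> reg.
have key k : {for a, continuous (orb c k)} -> \forall b \near a,
    [/\ orb c k b != 0, orb c k.+1 b = (orb c k b)^-1 - (dig c k a)%:~R
      & b - 1 < orb c k.+1 b < b].
  move=> ck; have [ak0 ak1] := reg k.
  have near0 : \forall b \near a, orb c k b != 0.
    exact: (cvgr_neq0 _ ck ak0).
  pose f b := (orb c k b)^-1 + 1 - b.
  have fa : {for a, continuous f}.
    apply: cvgB; last exact: cvg_id.
    by apply: cvgD; [exact: cvgV|exact: cvg_cst].
  have := @floor_near _ f a fa; rewrite -/(dig c k a).
  have -> : f a != (Num.floor (f a))%:~R.
    move: ak1; rewrite orbS//; apply: contra_neq => faE.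
    by rewrite /dig -/(f a) -faE /f; ring.
  move=> /(_ isT) near1; near=> b.
  have b0 : orb c k b != 0 by near: b.
  have : (dig c k a)%:~R < f b < (dig c k a)%:~R + 1 by near: b.
  move=> fb; have db : dig c k b = dig c k a.
    by apply: floor_def; rewrite intrD; move: fb; rewrite /f; lra.
  rewrite orbS// db; split => //; move: fb; rewrite /f; lra.
have cont : {for a, continuous (orb c n)}.
  elim: n => [|n IH].
    rewrite /orb/=; apply: cvgB; [exact: cvg_id|exact: cvg_cst].
  have [an0 _] := reg n; have nearE := key n IH.
  have : (orb c n b)^-1 - (dig c n a)%:~R @[b --> a] --> orb c n.+1 a.
    by rewrite orbS//; apply: cvgB; [exact: cvgV|exact: cvg_cst].
  apply: cvg_trans; apply: near_eq_cvg; near=> b.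
  by have [] : [/\ orb c n b != 0,
    orb c n.+1 b = (orb c n b)^-1 - (dig c n a)%:~R
      & b - 1 < orb c n.+1 b < b] by near: b.
by split; [|exact: key].
Unshelve. all: by end_near. Qed.

(** * Orbits bounded away from [a - 1] *)

Lemma int_squeeze (R : realType) (k m : int) :
  m%:~R - 1 < k%:~R :> R -> k%:~R < m%:~R + 1 :> R -> k = m.
Proof.
rewrite -[1]/(1%:~R) -intrB -intrD !ltr_int; lia.
Qed.

Definition golden (R : realType) : R := (Num.sqrt 5 - 1) / 2.

Lemma golden_eq (R : realType) : golden R ^+ 2 = 1 - golden R.
Proof.
have /sqr_sqrtr : (0 : R) <= 5 by [].
by rewrite /golden => h; field: h.
Qed.

Lemma golden_bounds (R : realType) : 61 / 100 < golden R < 62 / 100.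
Proof.
have := golden_eq R; have : 0 <= Num.sqrt 5 :> R by exact: sqrtr_ge0.
by rewrite /golden; nra.
Qed.

(** The golden mean [g] is a fixed point with digit 1, [|1/t - 1/g| = |t - g| / (t g)], and
    [t g > 1/4] in this range. *)
Lemma gauss_near_golden (R : realType) (e t : R) :
  e <= 1 / 10 -> `|t - golden R| < e -> `|gauss_map t - golden R| < 4 * e.
Proof.
move=> e10 te; have tg := te.
have /andP[g1 g2] := golden_bounds R; have gE := golden_eq R.
move: tg; rewrite ltr_norml => tg.
have t1 : 1 / 2 < t < 73 / 100 by lra.
have t0 : 0 < t by lra.
have ti : 1 < t^-1 < 2.
  by rewrite invf_gt1// -[2]invrK ltf_pV2 ?posrE//; lra.
rewrite (@gauss_map_eq _ t (t^-1 - 1) 1); [|by ring|lra].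
have -> : t^-1 - 1 - golden R = (golden R - t) / (t * golden R).
  have g0 : golden R != 0 by lra.
  have t0' : t != 0 by lra.
  have gi : (golden R)^-1 = 1 + golden R.
    by apply: (mulIf g0); rewrite mulVf//; lra.
  by rewrite -addrA -opprD -gi; field; apply/andP.
rewrite normrM normfV distrC (@gtr0_norm _ (t * _)); last nra.
rewrite ltr_pdivrMr; last nra.
have tg4 : 1 / 4 < t * golden R by nra.
have e0 : 0 < e by lra.
by apply: lt_trans te _; nra.
Qed.

Section gauss_tails.
Variables (R : realType) (a : R) (y : nat -> R).
(* The second hypothesis means [a < 1 - golden R]. *)
Hypotheses (a0 : 0 < a < 1 / 2) (ag : 0 < a ^+ 2 - 3 * a + 1).
Hypotheses (y0 : y 0 = a) (yn0 : forall n, y n != 0).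
Hypothesis yS : forall n, exists d : int,
  [/\ y n.+1 = (y n)^-1 - d%:~R, a - 1 < y n.+1 & y n.+1 < a].
Hypothesis ylow : forall n, - 1 < y n * (2 - a).

Let y_itv n : - (2 / 3) < y n <= a.
Proof.
have a0' := a0; have yl := ylow n; have lo : - (2 / 3) < y n.
  have : 0 < (2 / 3 + y n) * (2 - a) by lra.
  by rewrite pmulr_lgt0; lra.
rewrite lo /=; case: n {yl lo} => [|n]; first by rewrite y0.
by have [d [_ _ /ltW]] := yS n.
Qed.

Let tail m := exists n (k : int),
  y n = k%:~R + iter m (@gauss_map R) a \/ y n = k%:~R - iter m (@gauss_map R) a.

(** The bounds [-2/3 < y n <= a < 1/2] leave only these values of [k]. If the Gauss iterate were
    [0], then [y n] would be an integer, hence [0]. *)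
Let tail_cases m : tail m ->
  0 < iter m (@gauss_map R) a < 1 /\ exists n,
    [\/ y n = iter m (@gauss_map R) a, y n = - iter m (@gauss_map R) a,
        y n = 1 - iter m (@gauss_map R) a | y n = iter m (@gauss_map R) a - 1].
Proof.
have a0' := a0; rewrite /tail; set t := iter m _ _ => -[n [k yk]].
have t01 : 0 <= t < 1.
  rewrite /t; case: m {t yk} => [/=|m]; first lra.
  by rewrite iterS; exact: gauss_map_itv.
have yb := y_itv n.
have t0 : t != 0.
  apply/eqP => t0; have yke : y n = k%:~R by case: yk => ->; rewrite t0; ring.
  have : k = 0 by apply: (@int_squeeze R); rewrite -yke; lra.
  by move=> k0; have := yn0 n; rewrite yke k0 eqxx.
have {}t01 : 0 < t < 1 by rewrite lt0r t0; lra.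
split=> //; exists n; case: yk => yk.
- have [k0|k0] := leP 0 k.
    constructor 1; rewrite yk (_ : k = 0); first by ring.
    apply: (@int_squeeze R); last by rewrite mulr0z; lra.
    by have : (0 : int)%:~R <= k%:~R :> R; [rewrite ler_int|lra].
  constructor 4; rewrite yk (_ : k = -1); first by ring.
  apply: (@int_squeeze R); first by rewrite mulrN1z; lra.
  by have : k%:~R < (0 : int)%:~R :> R; [rewrite ltr_int|rewrite mulrN1z; lra].
- have [k0|k0] := leP k 0.
    constructor 2; rewrite yk (_ : k = 0); first by ring.
    apply: (@int_squeeze R); first by rewrite mulr0z; lra.
    by have : k%:~R <= (0 : int)%:~R :> R; [rewrite ler_int|lra].
  constructor 3; rewrite yk (_ : k = 1); first by ring.
  apply: (@int_squeeze R); last by rewrite mulr1z; lra.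
  by have : (0 : int)%:~R < k%:~R :> R; [rewrite ltr_int|rewrite mulr1z; lra].
Qed.

Lemma gauss_inv (t : R) : t^-1 = (Num.floor t^-1)%:~R + gauss_map t.
Proof. by rewrite /gauss_map; ring. Qed.

(** Write [G] for the Gauss map. Here [G t = (1 - t) / t], so [1 / (1 - t) = 1 + 1 / G t]: the
    reflection [t |-> 1 - t] absorbs one Gauss step. *)
Lemma gauss2_inv (t : R) : 1 / 2 < t < 1 ->
  (1 - t)^-1 = (1 + Num.floor (gauss_map t)^-1)%:~R + gauss_map (gauss_map t).
Proof.
move=> t1; have t0 : 0 < t by lra.
have ti : 1 < t^-1 < 2.
  by rewrite invf_gt1// -[2]invrK ltf_pV2 ?posrE//; lra.
rewrite intrD -addrA -gauss_inv (@gauss_map_eq _ t (t^-1 - 1) 1); last lra.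
  by field; rewrite !gt_eqF ?subr_gt0//; lra.
by ring.
Qed.

Let tail_reflected m n : let t := iter m (@gauss_map R) a in
  1 / 2 < t < 1 ->
  (y n = 1 - t -> exists k : int, y n.+1 = k%:~R + iter m.+2 (@gauss_map R) a) /\
  (y n = t - 1 -> exists k : int, y n.+1 = k%:~R - iter m.+2 (@gauss_map R) a).
Proof.
move=> t t12; have [d [-> _ _]] := yS n; rewrite !iterS -/t; split=> ->.
  rewrite gauss2_inv//; exists (1 + Num.floor (gauss_map t)^-1 - d).
  by rewrite [in RHS]intrB; ring.
rewrite -[t - 1]opprB invrN gauss2_inv//.
exists (- (1 + Num.floor (gauss_map t)^-1) - d).
by rewrite [in RHS]intrB [in RHS]intrN; ring.
Qed.

(** From [t] or [- t] the orbit makes one Gauss step; from [1 - t] or [t - 1] with [t > 1/2] it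
    makes two. There remains [t - 1] with [1/3 < t <= 1/2], where [t = 1/2] leads to an integer. *)
Let tail_next m : tail m -> tail m.+1 \/ tail m.+2.
Proof.
have a0' := a0; move=> /tail_cases; have [d_ yS_] := choice yS.
pose t := iter m (@gauss_map R) a; rewrite -/t => -[t01 [n ycases]].
have [yE yl yu] := yS_ n; have yb := y_itv n.
case: ycases => yt.
- left; exists n.+1, (Num.floor t^-1 - d_ n); left.
  by rewrite yE yt {1}gauss_inv intrB iterS -/t; ring.
- left; exists n.+1, (- Num.floor t^-1 - d_ n); right.
  by rewrite yE yt invrN {1}gauss_inv intrB intrN iterS -/t; ring.
- right; have [|+ _] := @tail_reflected m n; first by rewrite -/t; lra.
  by rewrite -/t => /(_ yt)[k ?]; exists n.+1, k; left.
have [t12|t12] := ltP (1 / 2) t.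
  right; have [|_ +] := @tail_reflected m n; first by rewrite -/t; lra.
  by rewrite -/t => /(_ yt)[k ?]; exists n.+1, k; right.
have t13 : 1 / 3 < t by lra.
have t0 : 0 < t by lra.
have ti : 2 <= t^-1 < 3.
  by rewrite -[2]invrK -[3]invrK ?lef_pV2 ?ltf_pV2 ?posrE//; lra.
have gt : gauss_map t = t^-1 - 2.
  by apply: (@gauss_map_eq _ _ _ 2); [ring|lra].
have [t2|t2] := eqVneq t (1 / 2).
  left; exists n.+1, (- 2%:Z - d_ n); left.
  rewrite iterS -/t gt t2 yE yt t2 intrB intrN.
  by rewrite -[2%:Z%:~R]/(2%:R); field.
have t12' : t < 1 / 2 by rewrite lt_neqAle t2 t12.
(* The lower bound [ylow] enters here; it forces the digit -2. *)
have yi : - 2 < (y n)^-1 < - (2 - a).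
  have yn : 1 / 2 < - y n by rewrite yt; lra.
  have yn_gt0 : 0 < - y n by lra.
  have lt2 : (- y n)^-1 < 2 by rewrite -[2]invrK ltf_pV2 ?posrE//; lra.
  have gt2a : 2 - a < (- y n)^-1.
    by rewrite -div1r ltr_pdivlMr//; have := ylow n; lra.
  by move: lt2 gt2a; rewrite invrN; lra.
have d2 : d_ n = - 2%:Z.
  apply: (@int_squeeze R); rewrite intrN -[2%:Z%:~R]/(2%:R); lra.
have g0 : 0 < gauss_map t.
  by rewrite gt subr_gt0 -[2]invrK ltf_pV2 ?posrE//; lra.
(* Now [y n.+1 = (1 - 2 t) / (1 - t)] and [G t = (1 - 2 t) / t], so two steps of [y] amount to two
   Gauss steps. *)
have yinv : (y n.+1)^-1 = 1 + (gauss_map t)^-1.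
  rewrite yE d2 yt gt intrN -[2%:Z%:~R]/(2%:R); field.
  by do ?[apply/andP; split]; apply/eqP => ?; lra.
right; exists n.+2, (1 + Num.floor (gauss_map t)^-1 - d_ n.+1); left.
have [-> _ _] := yS_ n.+1.
by rewrite yinv {1}gauss_inv !iterS -/t intrB intrD; ring.
Qed.

(** As at most one index is skipped, [tail j] holds for [j = m] or [j = m + 1]. Iterates [m] to
    [m + 3] are within [4^3 e = 64 e] of [g]. Values near [g] or [1 - g] exceed [a], and those near
    [- g] violate [ylow]. So [y n] is near [g - 1], and then [y n.+1] is near [k - g], which is
    impossible for every [k]. *)
Lemma tails_avoid_golden (e : R) (m : nat) : 64 * e <= 1 / 10 ->
  64 * e <= 1 - golden R - a -> 1 <= (golden R - 64 * e) * (2 - a) ->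
  ~ `|iter m (@gauss_map R) a - golden R| < e.
Proof.
have a0' := a0; move=> e1 e2 e3 h0.
have e0 : 0 < e by apply: le_lt_trans h0.
have h1 := gauss_near_golden _ h0; have {}h1 := h1 (_ : e <= 1 / 10).
have {}h1 := h1 ltac:(lra).
have h2 := @gauss_near_golden _ (4 * e) _ ltac:(lra) h1.
have h3 := @gauss_near_golden _ (4 * (4 * e)) _ ltac:(lra) h2.
have tailE : tail m \/ tail m.+1.
  elim: m {h0 h1 h2 h3} => [|m [/tail_next//|]]; last by left.
  by left; exists 0%N, 0; left; rewrite y0 /= add0r.
have [j [j0 j2 tj]] : exists j, [/\
    `|iter j (@gauss_map R) a - golden R| < 64 * e,
    `|iter j.+2 (@gauss_map R) a - golden R| < 64 * e & tail j].
  case: tailE => tj; [exists m|exists m.+1]; rewrite !iterS; split => //.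
  - by apply: lt_trans h0 _; lra.
  - by apply: lt_trans h2 _; lra.
  - by apply: lt_trans h1 _; lra.
  - by rewrite !mulrA -!natrM in h3.
have gb := golden_bounds R.
have absurd i n : `|iter i (@gauss_map R) a - golden R| < 64 * e ->
    [\/ y n = iter i (@gauss_map R) a, y n = - iter i (@gauss_map R) a
      | y n = 1 - iter i (@gauss_map R) a] -> False.
  rewrite ltr_norml; move: (iter i _ a) => t te.
  have := ylow n; have := y_itv n => yb yl; case=> yt; rewrite yt in yb yl.
  - by lra.
  - by nra.
  - by lra.
have [t01 [n yn]] := tail_cases tj.
case: yn => yn; [exact: absurd j0 (Or31 _ _ yn)|exact: absurd j0 (Or32 _ _ yn)
  |exact: absurd j0 (Or33 _ _ yn)|].
have t12 : 1 / 2 < iter j (@gauss_map R) a < 1.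
  by move: j0; rewrite ltr_norml; lra.
have [_ /(_ yn)[k yk]] := @tail_reflected j n t12.
have yb := y_itv n.+1; move: (j2); rewrite ltr_norml => j2'.
have [k0|k0] := leP k 0.
  have kR : k%:~R <= (0 : int)%:~R :> R by rewrite ler_int.
  have := ylow n.+1; rewrite yk; nra.
have kR : (1 : int)%:~R <= k%:~R :> R by rewrite ler_int.
by move: yb kR; rewrite yk mulr1z; lra.
Qed.

End gauss_tails.

(** * Matching in a neighbourhood of a parameter *)

(** Only the local form of the orbits is kept, so that reflected orbits are covered as well. The
    neighbourhood may depend on [n]. *)
Definition steps_near (R : realType) (a : R) (u : nat -> R -> R) : Prop :=
  forall n, exists d : int, \forall b \near a,
    [/\ u n b != 0, u n.+1 b = (u n b)^-1 - d%:~R & b - 1 < u n.+1 b < b].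

Definition matching_near (R : realType) (a : R) (u v : nat -> R -> R)
    (M N : nat) : Prop :=
  [/\ (0 < M)%N, (0 < N)%N
    & \forall b \near a, u M b = v N b /\ u M.-1 b <> v N.-1 b].

Lemma matching_near_sym (R : realType) (a : R) (u v : nat -> R -> R) M N :
  matching_near a u v M N -> matching_near a v u N M.
Proof.
move=> [M0 N0 near_uv]; split=> //; move: near_uv; apply: filterS => b [-> uv].
by split => // /esym.
Qed.

Section local_orbits.
Variables (R : realType) (a : R).

Lemma near_eq_int (f g : R -> R) (k : int) :
  (\forall b \near a, f b - g b = k%:~R) ->
  a - 1 < f a < a -> a - 1 < g a < a -> \forall b \near a, f b = g b.
Proof.
move=> fgk fa ga; have := nbhs_singleton fgk => fgka.
have k0 : k = 0 by apply: (@int_squeeze R); rewrite -fgka mulr0z; lra.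
by move: fgk; apply: filterS => b; rewrite k0 => /eqP; rewrite subr_eq0 => /eqP.
Qed.

Lemma recip_diff (u v : nat -> R -> R) (i j : nat) (k : int) :
  steps_near a u -> steps_near a v ->
  (\forall b \near a, (u i b)^-1 - (v j b)^-1 = k%:~R) ->
  \forall b \near a, u i.+1 b = v j.+1 b.
Proof.
move=> /(_ i)[d du] /(_ j)[e ev] uvk.
have [_ _ ua] := nbhs_singleton du; have [_ _ va] := nbhs_singleton ev.
apply: (@near_eq_int _ _ (k - d + e)) => //.
move: du ev uvk; apply: filterS3 => b [_ -> _] [_ -> _] uvk.
by rewrite intrD intrB -uvk; ring.
Qed.

Lemma recip_sum (u v : nat -> R -> R) (i j : nat) (k : int) :
  steps_near a u -> steps_near a v ->
  (\forall b \near a, (u i b)^-1 + (v j b)^-1 = k%:~R) ->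
  exists s : int, \forall b \near a, u i.+1 b + v j.+1 b = s%:~R.
Proof.
move=> /(_ i)[d du] /(_ j)[e ev] uvk; exists (k - d - e).
move: du ev uvk; apply: filterS3 => b [_ -> _] [_ -> _] uvk.
by rewrite !intrB -uvk; ring.
Qed.

Lemma matching_near_recip (u v : nat -> R -> R) (i j : nat) (k : int) :
  steps_near a u -> steps_near a v -> k != 0 ->
  (\forall b \near a, (u i b)^-1 - (v j b)^-1 = k%:~R) ->
  matching_near a u v i.+1 j.+1.
Proof.
move=> su sv k0 uvk; split => //=.
have := recip_diff su sv uvk; move: uvk; apply: filterS2 => b uvk uv.
split=> // uv'; move: uvk; rewrite uv' subrr => /esym/eqP.
by rewrite intr_eq0 (negPf k0).
Qed.

Hypotheses (a_gt0 : 0 < a) (a_lt : a < 1 / 2).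

Lemma near_gt0 : \forall b \near a, 0 < b.
Proof. exact: lt_nbhsr. Qed.

Lemma near_lt_half : \forall b \near a, b < 1 / 2.
Proof. exact: lt_nbhsl. Qed.

(** Put [y = v j.+1]. The bound forces its digit to be -1, so the next value is [(1 + y) / y]. Its
    reciprocal exceeds that of [u i.+1 = - (1 + y)] by 1. *)
Lemma sum_matching (u v : nat -> R -> R) (i j : nat) :
  steps_near a u -> steps_near a v ->
  (\forall b \near a, u i.+1 b + v j.+1 b = - 1) ->
  0 < a ^+ 2 - 3 * a + 1 -> v j.+1 a * (2 - a) <= - 1 ->
  matching_near a u v i.+2 j.+3.
Proof.
move=> su sv uv1 ag va2; have a0 := a_gt0; have a1 := a_lt.
have [d du] := su i; have [e ev] := sv j; have [e' ev'] := sv j.+1.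
have [_ _ va] := nbhs_singleton ev; have [va0 vE va'] := nbhs_singleton ev'.
have e'1 : e' = - 1.
  have v0 : v j.+1 a < 0 by nra.
  have vi : - (2 - a) <= (v j.+1 a)^-1.
    have vi0 : (v j.+1 a)^-1 < 0 by rewrite invr_lt0.
    by move: va2; rewrite -(ler_nM2l vi0) mulrA mulVf// mul1r; lra.
  have vi' : (v j.+1 a)^-1 * (a - 1) > 1.
    rewrite mulrC -[ltLHS](mulfV va0) ltr_nM2r ?invr_lt0//; lra.
  apply: (@int_squeeze R); rewrite mulrN1z.
    by move: vE va'; lra.
  by move: vE va' => ->; nra.
apply: (@matching_near_recip _ _ _ _ (- 1)) => //.
have near0 := near_gt0.
near=> b.
have b0 : 0 < b by near: b.
have [ub0 _ _] : [/\ u i b != 0, u i.+1 b = (u i b)^-1 - d%:~R &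
  b - 1 < u i.+1 b < b] by near: b.
have [_ _ vb] : [/\ v j b != 0, v j.+1 b = (v j b)^-1 - e%:~R &
  b - 1 < v j.+1 b < b] by near: b.
have [vb0 vS _] : [/\ v j.+1 b != 0, v j.+2 b = (v j.+1 b)^-1 - e'%:~R &
  b - 1 < v j.+2 b < b] by near: b.
have uE : u i.+1 b = - (1 + v j.+1 b).
  have : u i.+1 b + v j.+1 b = - 1 by near: b.
  lra.
have v1 : 1 + v j.+1 b != 0 by apply/eqP => ?; lra.
rewrite vS e'1 uE mulrN1z opprK; field.
by do ?[apply/andP; split] => //; apply/eqP => ?; lra.
Unshelve. all: by end_near. Qed.

(** As the sum is -1, each lower bound is an upper bound for the other orbit, and both digits are
    -2. With [y = v j.+1] the new values are [(1 + 2 y) / (1 + y)] and [(1 + 2 y) / y], whose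
    reciprocals add up to 1. The second exceeds [- a / (1 - a)], which is at least [-1 / (2 - a)] by
    the quadratic condition. *)
Lemma sum_avoiding (u v : nat -> R -> R) (i j : nat) :
  steps_near a u -> steps_near a v ->
  (\forall b \near a, u i.+1 b + v j.+1 b = - 1) ->
  0 < a ^+ 2 - 3 * a + 1 ->
  - 1 < u i.+1 a * (2 - a) -> - 1 < v j.+1 a * (2 - a) ->
  - 1 < v j.+2 a * (2 - a) /\
  exists s : int, \forall b \near a, u i.+3 b + v j.+3 b = s%:~R.
Proof.
move=> su sv uv1 ag ua2 va2; have a0 := a_gt0; have a1 := a_lt.
have digit (w : nat -> R -> R) n : steps_near a w -> - 1 < w n.+1 a * (2 - a) ->
    - 1 < (- 1 - w n.+1 a) * (2 - a) -> - 1 < w n.+2 a * (2 - a) /\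
    \forall b \near a, w n.+1 b != 0 /\ w n.+2 b = (w n.+1 b)^-1 + 2.
  move=> sw wlo whi; have [d dw] := sw n.+1.
  have [wa0 wE wa] := nbhs_singleton dw.
  have w0 : w n.+1 a < 0 by nra.
  have wi0 : (w n.+1 a)^-1 < 0 by rewrite invr_lt0.
  have wi : (w n.+1 a)^-1 < - (2 - a).
    by move: wlo; rewrite -(ltr_nM2l wi0) mulrA mulVf// mul1r; lra.
  have wi' : - (2 - a) < (w n.+1 a)^-1 * (1 - a).
    have : w n.+1 a * (2 - a) < - (1 - a) by lra.
    by rewrite -(ltr_nM2l wi0) mulrA mulVf// mul1r; lra.
  have wi3 : - (3 - a) < (w n.+1 a)^-1.
    by rewrite ltNge; apply/negP => le3; nra.
  have d2 : d = - 2%:Z.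
    by apply: (@int_squeeze R); rewrite mulrNz -[2%:Z%:~R]/(2%:R); lra.
  rewrite wE d2 mulrNz opprK -[2%:Z%:~R]/(2%:R); split.
    nra.
  move: dw; apply: filterS => b [? -> _].
  by rewrite d2 mulrNz opprK.
have uva := nbhs_singleton uv1.
have [|_ du] := digit u i su ua2; first by rewrite (_ : - 1 - _ = v j.+1 a)//; lra.
have [|v2 dv] := digit v j sv va2.
  by rewrite (_ : - 1 - _ = u i.+1 a)//; lra.
split => //; apply: (recip_sum (k := 1)) => //.
have [d du2] := su i.+2; have [e dv2] := sv j.+2.
near=> b.
have [ub0 uE] : u i.+1 b != 0 /\ u i.+2 b = (u i.+1 b)^-1 + 2 by near: b.
have [vb0 vE] : v j.+1 b != 0 /\ v j.+2 b = (v j.+1 b)^-1 + 2 by near: b.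
have [vb20 _ _] : [/\ v j.+2 b != 0, v j.+3 b = (v j.+2 b)^-1 - e%:~R &
  b - 1 < v j.+3 b < b] by near: b.
have uv : u i.+1 b = - (1 + v j.+1 b).
  have : u i.+1 b + v j.+1 b = - 1 by near: b.
  lra.
have v12 : 1 + 2 * v j.+1 b != 0.
  apply: contra vb20 => /eqP v0; rewrite vE; apply/eqP.
  by rewrite (_ : v j.+1 b = - (1 / 2)); [field|lra].
have v1 : 1 + v j.+1 b != 0 by move: ub0; rewrite uv oppr_eq0.
rewrite uE vE uv mulr1z; field.
by do ?[apply/andP; split] => //; apply/eqP => ?; lra.
Unshelve. all: by end_near. Qed.

End local_orbits.

(** These are the second iterates of [b - 1] with digits -2, 3 and of [b] with digits 3, -2. The
    hypothesis on the first excludes [b = 2/5]. *)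
Lemma third_recip_diff (R : realFieldType) (b : R) : 38 / 100 < b < 1 / 2 ->
  ((b - 1)^-1 + 2)^-1 - 3 != 0 ->
  (((b - 1)^-1 + 2)^-1 - 3)^-1 - ((b^-1 - 3)^-1 + 2)^-1 = - 1.
Proof.
move=> b12 u0; have b25 : 2 - 5 * b != 0.
  apply: contra u0 => /eqP b25; rewrite (_ : b = 2 / 5); last lra.
  by apply/eqP; field.
by field; do ?[apply/andP; split]; apply/eqP => ?; lra.
Qed.

Section first_matching.
Variables (R : realType) (a : R) (u v : nat -> R -> R).
Hypotheses (a_gt0 : 0 < a) (a_lt : a < 1 / 2).
Hypotheses (su : steps_near a u) (sv : steps_near a v).
Hypotheses (u0 : \forall b \near a, u 0 b = b - 1)
  (v0 : \forall b \near a, v 0 b = b).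

Let antipodal j := exists s : int, \forall b \near a, u j.+2 b + v j.+1 b = s%:~R.

Let low n := - 1 < v n a * (2 - a).

(** Both values lie in [(a - 1, a)], so the integer is 0 or -1. A sum 0 gives [v j.+1 a > - a] and
    passes to the next index. A sum -1 gives a match of index 0 or 2 unless both orbits are low, and
    then it skips one index. *)
Let antipodal_next j : 0 < a ^+ 2 - 3 * a + 1 ->
  (forall M N, matching_near a u v M N -> ~ (M = N \/ M = N.+2)) ->
  antipodal j -> low j.+1 /\ (antipodal j.+1 \/ low j.+2 /\ antipodal j.+2).
Proof.
move=> ag nomatch [s uvs]; have a0 := a_gt0; have a1 := a_lt.
have uva := nbhs_singleton uvs.
have [d du] := su j.+1; have [_ _ ua] := nbhs_singleton du.
have [e ev] := sv j; have [_ _ va] := nbhs_singleton ev.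
have s_gt : - 2 < s.
  by rewrite -(@ltr_int R) -uva mulrNz -[2%:~R]/(2%:R); lra.
have s_lt : s < 1 by rewrite -(@ltr_int R) -uva mulr1z; lra.
have [s0|s1] : s = 0 \/ s = - 1 by lia.
  split; first by rewrite /low; move: uva; rewrite s0 mulr0z; nra.
  left; apply: (recip_sum (k := 0)) => //; move: uvs; apply: filterS => b.
  by rewrite s0 mulr0z => /eqP; rewrite addr_eq0 => /eqP ->; rewrite invrN addNr.
rewrite s1 mulrN1z in uvs.
have vlow : low j.+1.
  rewrite /low ltNge; apply/negP => vle; apply: (nomatch j.+3 j.+3); last by left.
  exact: (sum_matching a_gt0 a_lt su sv uvs ag vle).
split => //; right.
have ulow : - 1 < u j.+2 a * (2 - a).
  rewrite ltNge; apply/negP => ule; apply: (nomatch j.+4 j.+2); last by right.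
  apply: matching_near_sym; apply: (sum_matching a_gt0 a_lt sv su _ ag ule).
  by move: uvs; apply: filterS => b; rewrite addrC.
exact: (sum_avoiding a_gt0 a_lt su sv uvs ag ulow vlow).
Qed.

Let low_all : 0 < a ^+ 2 - 3 * a + 1 ->
  (forall M N, matching_near a u v M N -> ~ (M = N \/ M = N.+2)) ->
  antipodal 0 -> forall n, low n.
Proof.
move=> ag nomatch anti0; have a0 := a_gt0; have a1 := a_lt.
have next j := @antipodal_next j ag nomatch.
have anti j : antipodal j \/ low j.+1 /\ antipodal j.+1.
  elim: j => [|j [/next[]|[_ ?]]]; [by left| |by left].
  by move=> _ [|]; [left|right].
case=> [|n]; last by case: (anti n) => [/next[]|[]].
by rewrite /low (nbhs_singleton v0); nra.
Qed.

Lemma first_digits : exists d e : int, [/\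
  \forall b \near a, u 1 b != 0 /\ u 1 b = (b - 1)^-1 - d%:~R,
  \forall b \near a, v 1 b != 0 /\ v 1 b = b^-1 - e%:~R,
  a - 1 < (a - 1)^-1 - d%:~R < a, a - 1 < a^-1 - e%:~R < a & d = - 1 \/ d = - 2%:Z].
Proof.
have a0 := a_gt0; have a1 := a_lt.
have [d du] := su 0%N; have [d' du'] := su 1%N.
have [e ev] := sv 0%N; have [e' ev'] := sv 1%N.
have nu : \forall b \near a, u 1 b != 0 /\ u 1 b = (b - 1)^-1 - d%:~R.
  move: u0 du du'; apply: filterS3 => b u0b [_ uE _] [ub _ _].
  by split=> //; rewrite uE u0b.
have nv : \forall b \near a, v 1 b != 0 /\ v 1 b = b^-1 - e%:~R.
  move: v0 ev ev'; apply: filterS3 => b v0b [_ vE _] [vb _ _].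
  by split=> //; rewrite vE v0b.
exists d, e; split=> //.
- by have [_ uE] := nbhs_singleton nu; have [_ _] := nbhs_singleton du; rewrite uE.
- by have [_ uE] := nbhs_singleton nv; have [_ _] := nbhs_singleton ev; rewrite uE.
have [_ uE] := nbhs_singleton nu; have [_ _] := nbhs_singleton du.
rewrite uE => ua; have an0 : a - 1 != 0 by apply/eqP => ?; lra.
have := mulVf an0; move: (a - 1)^-1 ua => r ua r1.
have d_gt : - 3 < d by rewrite -(@ltr_int R) mulrNz -[3%:~R]/(3%:R); nra.
have d_lt : d < 0 by rewrite -(@ltr_int R) mulr0z; nra.
lia.
Qed.

Lemma local_matching :
  (0 < a ^+ 2 - 3 * a + 1 -> exists e m, [/\ 64 * e <= 1 / 10,
     64 * e <= 1 - golden R - a, 1 <= (golden R - 64 * e) * (2 - a) &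
     `|iter m (@gauss_map R) a - golden R| < e]) ->
  exists M N, matching_near a u v M N /\ (M = N \/ M = N.+2).
Proof.
move=> tails; have a0 := a_gt0; have a1 := a_lt.
have [d [e [nu nv ua va dE]]] := first_digits.
have an0 : a - 1 != 0 by apply/eqP => ?; lra.
have an0' : a != 0 by apply/eqP => ?; lra.
have rE := mulVf an0; have sE := mulVf an0'.
have near0 := near_gt0 a_gt0; have near1 := near_lt_half a_lt.
case: dE => dE.
  have ag : 0 < a ^+ 2 - 3 * a + 1.
    move: ua rE; rewrite dE mulrN1z; move: (a - 1)^-1 => r; nra.
  apply: contrapT => nomatch.
  have {}nomatch M N : matching_near a u v M N -> ~ (M = N \/ M = N.+2).
    by move=> mMN MN; apply: nomatch; exists M, N.
  have [d' du'] := su 1%N; have [e' ev'] := sv 0%N.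
  have anti0 : antipodal 0.
    (* The digit -1 gives [u 1 b = b / (b - 1)], whose reciprocal is [1 - 1/b]. *)
    exists (1 - d' - e); near=> b.
    have [] : u 1 b != 0 /\ u 1 b = (b - 1)^-1 - d%:~R by near: b.
    have [] : v 1 b != 0 /\ v 1 b = b^-1 - e%:~R by near: b.
    have [_ -> _] : [/\ u 1 b != 0, u 2 b = (u 1 b)^-1 - d'%:~R &
      b - 1 < u 2 b < b] by near: b.
    have b0 : 0 < b by near: b.
    have b1 : b < 1 / 2 by near: b.
    move=> _ -> _ ->; rewrite dE !intrB mulrN1z mulr1z opprK.
    by field; do ?[apply/andP; split]; apply/eqP => ?; lra.
  have [eps [m [e1 e2 e3]]] := tails ag.
  apply: (@tails_avoid_golden _ a (fun n => v n a)) => //; first by rewrite a0.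
  - exact: nbhs_singleton v0.
  - by move=> n; have [k kv] := sv n; have [] := nbhs_singleton kv.
  - move=> n; have [k kv] := sv n; exists k.
    by have [_ -> /andP[]] := nbhs_singleton kv.
  - exact: low_all.
(* The digit -2 means [a > 1 - g]; then all digits needed are explicit and the orbits match after
   two or three steps. *)
have ag : a ^+ 2 - 3 * a + 1 < 0.
  by move: ua rE; rewrite dE mulrNz -[2%:~R]/(2%:R); move: (a - 1)^-1 => r; nra.
have a38 : 38 / 100 < a by nra.
have e_gt : 1 < e.
  by rewrite -(@ltr_int R) mulr1z; move: va sE; move: a^-1 => s; nra.
have e_lt : e < 4.
  by rewrite -(@ltr_int R) -[4%:~R]/(4%:R); move: va sE; move: a^-1 => s; nra.
have [e2|e3] : e = 2 \/ e = 3.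
  move: e_gt e_lt; case: (e) => [[|[|[|[|n]]]]|n] // _ _; first by left.
  by right.
  exists 2%N, 2%N; split; [|by left].
  apply: (@matching_near_recip _ _ _ _ 1 1 1) => //; near=> b.
  have [] : u 1 b != 0 /\ u 1 b = (b - 1)^-1 - d%:~R by near: b.
  have [] : v 1 b != 0 /\ v 1 b = b^-1 - e%:~R by near: b.
  have b0 : 0 < b by near: b.
  have b1 : b < 1 / 2 by near: b.
  move=> _ -> _ ->; rewrite dE e2 mulrNz mulr1z opprK -[2%:~R]/(2%:R).
  by field; do ?[apply/andP; split]; apply/eqP => ?; lra.
exists 3%N, 3%N; split; [|by left].
have [d' du'] := su 1%N; have [e' ev'] := sv 1%N.
have [ua0 ua1] := nbhs_singleton nu; have [va0 va1] := nbhs_singleton nv.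
have [_ ua2 ua2'] := nbhs_singleton du'; have [_ va2 va2'] := nbhs_singleton ev'.
have aa : a ^+ 2 + 2 * a < 1.
  by move: va sE; rewrite e3 -[3%:~R]/(3%:R); move: a^-1 => s; nra.
have d'3 : d' = 3.
  have qE : (u 1 a)^-1 * (2 * a - 1) = a - 1.
    rewrite ua1 dE mulrNz opprK -[2%:~R]/(2%:R).
    by field; do ?[apply/andP; split]; apply/eqP => ?; lra.
  by apply: (@int_squeeze R); rewrite -[3%:~R]/(3%:R); move: ua2 ua2' qE;
    move: (u 1 a)^-1 (u 2 a) => q w -> *; nra.
have e'2 : e' = - 2%:Z.
  have qE : (v 1 a)^-1 * (1 - 3 * a) = a.
    rewrite va1 e3 -[3%:~R]/(3%:R).
    by field; do ?[apply/andP; split]; apply/eqP => ?; lra.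
  by apply: (@int_squeeze R); rewrite mulrNz -[2%:~R]/(2%:R);
    move: va2 va2' qE; move: (v 1 a)^-1 (v 2 a) => q w -> *; nra.
apply: (@matching_near_recip _ _ _ _ 2 2 (- 1)) => //.
have [d2 du2] := su 2%N; have [e2 ev2] := sv 2%N.
have near38 : \forall b \near a, 38 / 100 < b by exact: lt_nbhsr.
near=> b.
have [u20 _ _] : [/\ u 2 b != 0, u 3 b = (u 2 b)^-1 - d2%:~R &
  b - 1 < u 3 b < b] by near: b.
have [] : u 1 b != 0 /\ u 1 b = (b - 1)^-1 - d%:~R by near: b.
have [] : v 1 b != 0 /\ v 1 b = b^-1 - e%:~R by near: b.
have [_ uE _] : [/\ u 1 b != 0, u 2 b = (u 1 b)^-1 - d'%:~R &
  b - 1 < u 2 b < b] by near: b.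
have [_ -> _] : [/\ v 1 b != 0, v 2 b = (v 1 b)^-1 - e'%:~R &
  b - 1 < v 2 b < b] by near: b.
have b38 : 38 / 100 < b by near: b.
have b1 : b < 1 / 2 by near: b.
move=> _ vE _ u1E; move: u20; rewrite uE u1E vE dE d'3 e3 e'2.
rewrite !mulrNz !opprK -[2%:~R]/(2%:R) -[3%:~R]/(3%:R) => u20.
by apply: third_recip_diff => //; rewrite b38.
Unshelve. all: by end_near. Qed.

End first_matching.

(** * Typical parameters *)

Lemma near_reflect (R : realType) (a : R) (P : set R) :
  (\forall b \near a, P b) -> \forall b \near 1 - a, P (1 - b).
Proof.
move=> aP; have : (1 - b) @[b --> 1 - a] --> a.
  rewrite -[X in _ --> X](_ : 1 - (1 - a) = a); last by ring.
  by apply: cvgB; [exact: cvg_cst|exact: cvg_id].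
by apply.
Qed.

Definition reflect_orbit (R : realType) (u : nat -> R -> R) (n : nat) (b : R) :=
  - u n (1 - b).

Lemma steps_near_reflect (R : realType) (a : R) (u : nat -> R -> R) :
  steps_near a u -> steps_near (1 - a) (reflect_orbit u).
Proof.
move=> su n; have [d du] := su n; exists (- d).
move: (near_reflect du); apply: filterS => b [u0 uE ub]; rewrite /reflect_orbit.
by rewrite oppr_eq0 u0 {1}uE invrN mulrNz; split; [|ring|lra].
Qed.

(** Reflection exchanges the two endpoints, hence also the two exponents. *)
Lemma matching_near_reflect (R : realType) (a : R) (u v : nat -> R -> R) M N :
  matching_near (1 - a) (reflect_orbit v) (reflect_orbit u) M N ->
  matching_near a u v N M.
Proof.
move=> [M0 N0 near_uv]; split => //; move: (near_reflect near_uv).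
rewrite (_ : 1 - (1 - a) = a); last by ring.
apply: filterS => b; rewrite /reflect_orbit (_ : 1 - (1 - b) = b); last by ring.
move=> [/oppr_inj -> neq]; split => // /esym eq; apply: neq; by rewrite eq.
Qed.

(* The Gauss orbits of [a] and [1 - a] agree, up to a shift, only from the
   second iterate on. *)
Definition golden_tails (R : realType) (a : R) : Prop := forall n, exists2 m,
  (1 < m)%N & `|iter m (@gauss_map R) a - golden R| < (n + 10)%:R^-1.

Definition typical (R : realType) (a : R) : Prop :=
  [/\ 0 < a < 1, a != 1 / 2, orb_regular 0 a, orb_regular 1 a & golden_tails a].

(** [G (1 - a) = a / (1 - a)], and its reciprocal is [1/a - 1]. *)
Lemma gauss2_reflect (R : realType) (a : R) : 0 < a < 1 / 2 ->
  gauss_map (gauss_map (1 - a)) = gauss_map a.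
Proof.
move=> a12; have a0 : a != 0 by apply/eqP => ?; lra.
have a1 : 1 - a != 0 by apply/eqP => ?; lra.
have aE : (1 - a)^-1 = 1%:~R + a / (1 - a) by field.
rewrite (gauss_map_eq aE); last first.
  by rewrite ltr_pdivrMr ?divr_ge0; lra.
apply: (@gauss_map_eq _ _ _ (Num.floor a^-1 - 1)); last exact: gauss_map_itv.
by rewrite intrB /gauss_map invf_div; field.
Qed.

Lemma golden_tails_reflect (R : realType) (a : R) : 1 / 2 < a < 1 ->
  golden_tails a -> forall n, exists m,
  `|iter m (@gauss_map R) (1 - a) - golden R| < (n + 10)%:R^-1.
Proof.
move=> a12 tails n; have [[//|[//|m]] _] := tails n => ma; exists m.+1.
move: ma; rewrite -[in X in X -> _](_ : 1 - (1 - a) = a); last by ring.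
by rewrite -addn2 iterD -[m.+1]addn1 iterD /= gauss2_reflect//; lra.
Qed.

Lemma golden_tails_dist (R : realType) (a : R) : 0 < a < 1 / 2 ->
  (forall n, exists m,
    `|iter m (@gauss_map R) a - golden R| < (n + 10)%:R^-1) ->
  0 < a ^+ 2 - 3 * a + 1 -> exists e m, [/\ 64 * e <= 1 / 10,
    64 * e <= 1 - golden R - a, 1 <= (golden R - 64 * e) * (2 - a)
    & `|iter m (@gauss_map R) a - golden R| < e].
Proof.
move=> a12 tails ag; have /andP[g1 g2] := golden_bounds R.
have gE := golden_eq R.
have ga : 0 < 1 - golden R - a by nra.
have ga2 : 0 < golden R * (2 - a) - 1 by nra.
have [r [r0 rl1 rl2 rl3]] : exists r, [/\ 0 < r, r <= 1 / 1000,
    r <= 1 - golden R - a & r <= golden R * (2 - a) - 1].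
  move: (1 - _ - _) (_ - 1) ga ga2 => x y x0 y0.
  exists (Num.min (1 / 1000) (Num.min x y)).
  have k0 : 0 < 1 / 1000 :> R by lra.
  by rewrite 2!lt_min k0 x0 y0 !ge_min !lexx !orbT.
(* The radius [e] then satisfies [128 e < r]; the factor is [64] times the bound 2 for [2 - a]. *)
have [m] := tails (Num.truncn (128 / r)).
have K0 : 0 < (Num.truncn (128 / r) + 10)%:R :> R by rewrite ltr0n addn_gt0 orbT.
have : 128 / r < (Num.truncn (128 / r) + 10)%:R.
  by apply: lt_le_trans (truncnS_gt _) _; rewrite ler_nat -addn1 leq_add2l.
rewrite ltr_pdivrMr// mulrC; move: (_ + 10)%:R K0 => K K0 rK.
have er : 128 * K^-1 < r by rewrite ltr_pdivrMr.
have : 0 < K^-1 by rewrite invr_gt0.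
move: K^-1 er => e er e0 me.
exists e, m; split => //; [lra|lra|].
nra.
Qed.

Lemma typical_matching (R : realType) (a : R) : typical a ->
  exists M N, [/\ matching_near a (orb 1) (orb 0) M N,
    a < 1 / 2 -> M = N \/ M = N.+2 & 1 / 2 < a -> M = N \/ N = M.+2].
Proof.
move=> [a01 a12 reg0 reg1 tails].
have steps c : orb_regular c a -> steps_near a (orb c).
  by move=> reg n; exists (dig c n a); have [] := orb_local n reg.
have [alt|agt] := ltP a (1 / 2).
  have [|||||||M [N [mMN MN]]] := @local_matching R a (orb 1) (orb 0).
  - by case/andP: a01.
  - by [].
  - exact: steps.
  - exact: steps.
  - by apply: (@filterE _ (nbhs _)) => b; rewrite /orb.
  - by apply: (@filterE _ (nbhs _)) => b; rewrite /orb/= subr0.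
  - apply: golden_tails_dist; first by lra.
    by move=> n; have [m _ mn] := tails n; exists m.
  - by exists M, N; split => // ?; exfalso; lra.
have {}agt : 1 / 2 < a by rewrite lt_neqAle eq_sym a12 agt.
have [|||||||M [N [/matching_near_reflect mMN MN]]] :=
  @local_matching R (1 - a)
  (reflect_orbit (orb 0)) (reflect_orbit (orb 1)).
- by lra.
- by lra.
- by apply: steps_near_reflect; exact: steps.
- by apply: steps_near_reflect; exact: steps.
- by apply: (@filterE _ (nbhs _)) => b; rewrite /reflect_orbit /orb/=; ring.
- by apply: (@filterE _ (nbhs _)) => b; rewrite /reflect_orbit /orb/=; ring.
- apply: golden_tails_dist; first by lra.
  by apply: golden_tails_reflect => //; lra.
by exists N, M; split => // _; case: MN => ->; [left|right].
Qed.

Lemma gauss_terminating_countable (R : realType) :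
  countable [set a : R | exists i, iter i (@gauss_map R) a = 0].
Proof.
apply: (@sub_countable _ _ _ [set ratr q | q in [set: rat]]); last first.
  apply: (@sub_countable _ _ _ [set: rat]); first exact: card_image_le.
  exact: countableP.
apply: subset_card_le => a [i ai]; suff [q ->] : exists q, a = ratr q by exists q.
have : exists q, iter i (@gauss_map R) a = ratr q.
  by exists 0; rewrite ai rmorph0.
elim: i {ai} => // i IH [q qE]; apply: IH.
move: qE; rewrite iterS; move: (iter i _ a) => x xq.
exists ((q + (Num.floor x^-1)%:~R)^-1).
by rewrite fmorphV rmorphD /= ratr_int -xq /gauss_map subrK invrK.
Qed.

Lemma negligible_countable (R : realType) (A : set R) :
  countable A -> (@lebesgue_measure R).-negligible A.
Proof.
move=> cA; exists A; split => //; first exact: countable_measurable.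
exact: countable_lebesgue_measure0.
Qed.

(** Apart from countably many parameters, failure to be typical means that the Gauss orbit avoids a
    window around [g] from the second iterate on. *)
Lemma atypical_negligible (R : realType) :
  (@lebesgue_measure R).-negligible [set a | 0 <= a <= 1 /\ ~ typical a].
Proof.
pose avoid k : set R := [set x | [/\ 0 < x < 1,
  (forall i, iter i (@gauss_map R) x != 0) & forall m, (2 <= m)%N ->
  ~ (golden R - (k + 10)%:R^-1 < iter m (@gauss_map R) x
      < golden R + (k + 10)%:R^-1)]].
pose irreg c : set R := [set a | [/\ 0 < a < 1, a != c & ~ orb_regular c a]].
have cnt : (@lebesgue_measure R).-negligible
    ([set 0] `|` [set 1] `|` [set 1 / 2] `|` irreg 0 `|` irreg 1 `|`
     [set a : R | exists i, iter i (@gauss_map R) a = 0]).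
  do ![apply: negligibleU]; apply: negligible_countable; try exact: countable1.
  - by apply: countable_orb_irregular; rewrite lexx ler01.
  - by apply: countable_orb_irregular; rewrite lexx ler01.
  - exact: gauss_terminating_countable.
have neg_avoid : (@lebesgue_measure R).-negligible (\bigcup_k avoid k).
  apply: negligible_bigcup => k; have /andP[g1 g2] := golden_bounds R.
  have k10 : 10 <= (k + 10)%:R :> R by rewrite (ler_nat _ 10) leq_addl.
  have k0 : 0 < (k + 10)%:R^-1 :> R by rewrite invr_gt0; lra.
  have k1 : (k + 10)%:R^-1 <= 1 / 10 :> R by rewrite -div1r ler_pdivrMr; lra.
  by apply: gauss_avoid_negligible; lra.
apply: negligibleS (negligibleU cnt neg_avoid) => a [a01 atyp].
apply: contrapT => abad; apply: atyp.
have a0 : a != 0 by apply/eqP => aE; apply: abad; do 6!left.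
have a1 : a != 1 by apply/eqP => aE; apply: abad; do 5!left; right.
have {}a01 : 0 < a < 1.
  by case/andP: a01 => ? ?; rewrite !lt_neqAle eq_sym a0 a1; apply/andP.
have term i : iter i (@gauss_map R) a != 0.
  by apply/eqP => ai; apply: abad; left; right; exists i.
split => //.
- by apply/eqP => aE; apply: abad; do 4!left; right.
- by apply: contrapT => ?; apply: abad; do 3!left; right.
- by apply: contrapT => ?; apply: abad; do 2!left; right.
move=> k; apply: contrapT => nm; apply: abad; right; exists k => //.
split => // m m2 mk; apply: nm; exists m => //; rewrite ltr_norml; lra.
Qed.

(** * Matching intervals *)

Lemma matching_on_local (R : realType) (a : R) (M N : nat) : 0 < a < 1 ->
  matching_near a (orb 1) (orb 0) M N -> exists J, matching_on M N J /\ J a.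
Proof.
move=> a01 [M0 N0 near_match].
have near01 : \forall b \near a, 0 <= b <= 1.
  near=> b; apply/andP; split; apply: ltW; near: b.
    by apply: lt_nbhsr; lra.
  by apply: lt_nbhsl; lra.
have /nbhs_ballP[e /= e0 ae] : \forall b \near a,
    (orb 1 M b = orb 0 N b /\ orb 1 M.-1 b <> orb 0 N.-1 b) /\ 0 <= b <= 1.
  by move: near_match near01; apply: filterS2.
exists (ball a e); split; last exact: ballxx.
split; split => //.
- by exists a; exact: ballxx.
- exact: ball_open.
- by rewrite ball_itv; exact: interval_is_interval.
- by move=> b /ae[_ b01]; rewrite /= in_itv.
- by move=> b /ae[[+ _] _]; rewrite /orb subr0.
- by apply: aeW => b /ae[[_ +] _]; rewrite /orb subr0.
Unshelve. all: by end_near. Qed.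

(** This union provides the maximal interval through [a]. It is convex because all members contain
    [a]. *)
Lemma matching_on_bigcup (R : realType) (a : R) (M N : nat) :
  (exists J, matching_on M N J /\ J a) ->
  matching_on M N (\bigcup_(J in [set J : set R | matching_on M N J /\ J a]) J).
Proof.
move=> [J0 [mJ0 J0a]]; have [_ [M0 N0 _ _]] := mJ0; set U := \bigcup_(_ in _) _.
split; split => //.
- by exists a, J0.
- by apply: bigcup_open => J [[[]]].
- move=> x y [Jx [mJx Jxa] xJ] [Jy [mJy Jya] yJ] z /andP[xz zy].
  have [_ _ iJx _] := mJx.1; have [_ _ iJy _] := mJy.1.
  have [za|az] := leP z a.
    by exists Jx => //; apply: (iJx x a) => //; rewrite xz za.
  by exists Jy => //; apply: (iJy a y) => //; rewrite zy (ltW az).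
- by move=> x [J [[[_ _ _ +] _] _] Jx]; apply.
- by move=> x [J [[_ [_ _ + _]] _] Jx]; apply.
pose P (b : R) := iter M.-1 (tanaka_ito b) (b - 1) <> iter N.-1 (tanaka_ito b) b.
(* The union may be uncountable, so its exceptional set is covered by those of countably many
   rational intervals, each inside one member. *)
pose F (pq : rat * rat) : set R := [set b | [/\
  exists J : set R, matching_on M N J /\ `]ratr pq.1, ratr pq.2[ `<=` J,
  b \in `]ratr pq.1, ratr pq.2[ & ~ P b]].
have negF pq : (@lebesgue_measure R).-negligible (F pq).
  have [[J [mJ pqJ]]|nJ] := pselect (exists J : set R, matching_on M N J /\
      `]ratr pq.1, ratr pq.2[ `<=` J); last first.
    by apply: negligibleS (negligible_set0 _) => b [].
  have [_ [_ _ _]] := mJ; apply: negligibleS => b [_ /pqJ Jb nP] /=.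
  by move/(_ Jb).
have negU : (@lebesgue_measure R).-negligible
    (\bigcup_n (if choice.unpickle n is Some pq then F pq else set0)).
  apply: negligible_bigcup => n.
  by case: choice.unpickle => [pq|]; [exact: negF|exact: negligible_set0].
apply: negligibleS negU => b /not_implyP[[J [mJ _] Jb] nP].
have [_ oJ _ _] := mJ.1.
have /nbhs_ballP[e /= e0 bJ] := open_nbhs_nbhs (conj oJ Jb).
have [p pb] := @rat_in_itvoo R (b - e) b ltac:(lra).
have [q qb] := @rat_in_itvoo R b (b + e) ltac:(lra).
exists (choice.pickle (p, q)); [exact: I|rewrite choice.pickleK].
move: pb qb; rewrite !in_itv/= => pb qb.
split => //; last by rewrite in_itv/=; lra.
exists J; split => // x; rewrite /= in_itv/= => pxq; apply: bJ.
by rewrite /ball/= ltr_norml; lra.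
Qed.

Lemma matching_on_matching_set (R : realType) (a : R) (M N : nat) :
  (exists J, matching_on M N J /\ J a) -> matching_set a.
Proof.
move=> exJ; have mU := matching_on_bigcup exJ; have [J [mJ Ja]] := exJ.
exists M, N, (\bigcup_(J in [set J : set R | matching_on M N J /\ J a]) J).
split; last by exists J.
split=> // J' mJ' UJ'; apply/seteqP; split => // x J'x; exists J' => //.
by split => //; apply: UJ'; exists J.
Qed.

Lemma matching_set_open (R : realType) : open (@matching_set R).
Proof.
rewrite (_ : @matching_set R = \bigcup_(J in [set J : set R |
    exists M N, matching_interval M N J]) J).
  by apply: bigcup_open => J [M [N [[[]]]]].
apply/seteqP; split=> [a [M [N [J [mJ Ja]]]]|a [J [M [N mJ]] Ja]].
  by exists J => //; exists M, N.
by exists M, N, J.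
Qed.

Lemma orb_matching_shift (R : realType) (a : R) (M N k : nat) :
  orb 1 M a = orb 0 N a -> orb 1 (k + M) a = orb 0 (k + N) a.
Proof. by rewrite /orb !iterD => ->. Qed.

Lemma open_not_negligible (R : realType) (K : set R) : open K -> K !=set0 ->
  ~ (@lebesgue_measure R).-negligible K.
Proof.
move=> oK [x Kx] [A [mA A0 KA]].
have /nbhs_ballP[e /= e0 xK] := open_nbhs_nbhs (conj oK Kx).
have : (lebesgue_measure (ball x e) <= lebesgue_measure A)%E.
  apply: le_measure; rewrite ?inE//; first exact: measurable_ball.
  exact: subset_trans KA.
rewrite A0 lebesgue_measure_ball; last exact: ltW.
by rewrite lee_fin leNgt pmulrn_lgt0// e0.
Qed.

(** Following both matchings gives [y_(N + M0) = y_(N0 + M)]. If these times always differed,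
    expansion would allow only one typical parameter of [K] for each pair [(M0, N0)] and digit
    string, hence countably many, although they fill [K] up to a null set. *)
Lemma matching_exponents (R : realType) (M N : nat) (K : set R)
    (Q : nat -> nat -> Prop) :
  open K -> K !=set0 -> K `<=` `[0, 1] ->
  (forall b, K b -> iter M (tanaka_ito b) (b - 1) = iter N (tanaka_ito b) b) ->
  (forall b, K b -> typical b ->
     exists M0 N0, Q M0 N0 /\ orb 1 M0 b = orb 0 N0 b) ->
  exists M0 N0, Q M0 N0 /\ (N + M0 = N0 + M)%N.
Proof.
move=> oK K0 K01 KMN KQ; apply: contrapT => noQ.
have KQ' b : exists MN0 : nat * nat, K b -> typical b ->
    Q MN0.1 MN0.2 /\ orb 1 MN0.1 b = orb 0 MN0.2 b.
  have [[Kb tb]|nb] := pselect (K b /\ typical b); last first.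
    by exists (0, 0)%N => Kb tb; exfalso; apply: nb.
  by have [M0 [N0 QMN]] := KQ b Kb tb; exists (M0, N0).
have [f fP] := choice KQ'.
(* The sum bounds both times that have to be compared. *)
pose len b := (N + (f b).1 + ((f b).2 + M))%N.
have cK : countable (K `&` [set b | typical b]).
  apply/countable_injP.
  exists (fun b => choice.pickle (f b, mkseq (fun i => dig 0 i b) (len b))).
  move=> a b /set_mem[Ka ta] /set_mem[Kb tb] /(pcan_inj (@choice.pickleK _)).
  move=> [fab digab]; apply/eqP/negPn/negP => ab.
  have [Qa Ma] := fP a Ka ta; have [Qb Mb] := fP b Kb tb.
  have MNx x : K x -> typical x -> f x = f a ->
      orb 0 (N + (f a).1) x = orb 0 ((f a).2 + M) x.
    move=> Kx tx fx; have [_ Mx] := fP x Kx tx; rewrite fx in Mx.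
    have := KMN x Kx; rewrite -[iter M _ _]/(orb 1 M x) -{3}[x]subr0.
    rewrite -[iter N _ _]/(orb 0 N x) => MN.
    rewrite addnC -(orb_matching_shift _ MN) [X in orb 0 X]addnC.
    by rewrite -(orb_matching_shift _ Mx) addnC.
  have neq : (N + (f a).1 != (f a).2 + M)%N.
    by apply/eqP => eqn; apply: noQ; exists (f a).1, (f a).2.
  have [a01 _ rega _ _] := ta; have [b01 _ regb _ _] := tb.
  have lt m n : (m < n)%N -> (n <= len a)%N ->
      `|orb 0 m a - orb 0 m b| < `|orb 0 n a - orb 0 n b|.
    move=> mn nlen; apply: orb_lt_dist => //; first by rewrite lexx ler01.
    move=> i ilt; split; [by case: (rega i)|by case: (regb i)|].
    have := congr1 (fun s => nth 0 s i) digab.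
    have lab : len a = len b by rewrite /len fab.
    by rewrite !nth_mkseq// -?lab; exact: leq_trans nlen.
  have Ea := MNx a Ka ta erefl; have Eb := MNx b Kb tb (esym fab).
  move: neq; rewrite neq_ltn => /orP[] mn.
    by have := lt _ _ mn (leq_addl _ _); rewrite Ea Eb ltxx.
  by have := lt _ _ mn (leq_addr _ _); rewrite Ea Eb ltxx.
apply: (open_not_negligible oK K0).
have := negligibleU (negligible_countable cK) (atypical_negligible R).
apply: negligibleS => b Kb; have [tb|ntb] := pselect (typical b); first by left.
by right; split => //; have := K01 b Kb; rewrite /= in_itv.
Qed.

(** An open [J] that contains [a <= 1/2] also contains parameters below [1/2], so the endpoint [1/2]
    is covered. *)
Lemma matching_index_low (R : realType) (M N : nat) (J : set R) (a : R) :
  matching_interval M N J -> J a -> a <= 1 / 2 ->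
  matching_index M N = 0 \/ matching_index M N = 2.
Proof.
move=> [[[_ oJ _ J01] [_ _ JMN _]] _] Ja a12.
have [||||b [Jb b12] tb|M0 [N0 [MN0 eqMN]]] := @matching_exponents R M N
  (J `&` [set` `]-oo, 1 / 2[]) (fun M0 N0 => M0 = N0 \/ M0 = N0.+2).
- by apply: openI => //; exact: interval_open.
- have /nbhs_ballP[e /= e0 aJ] := open_nbhs_nbhs (conj oJ Ja).
  exists (a - e / 2); split; last by rewrite /= in_itv/=; lra.
  by apply: aJ; rewrite /ball/= ltr_norml; lra.
- by move=> b [/J01].
- by move=> b [/JMN].
- have [M0 [N0 [[_ _ mMN] lo _]]] := typical_matching tb.
  exists M0, N0; split; first by apply: lo; move: b12; rewrite /= in_itv.
  by have [] := nbhs_singleton mMN.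
by rewrite /matching_index; case: MN0 => M0E; rewrite M0E in eqMN; [left|right]; lia.
Qed.

Lemma matching_index_high (R : realType) (M N : nat) (J : set R) (a : R) :
  matching_interval M N J -> J a -> 1 / 2 <= a ->
  matching_index M N = 0 \/ matching_index M N = - 2.
Proof.
move=> [[[_ oJ _ J01] [_ _ JMN _]] _] Ja a12.
have [||||b [Jb b12] tb|M0 [N0 [MN0 eqMN]]] := @matching_exponents R M N
  (J `&` [set` `]1 / 2, +oo[]) (fun M0 N0 => M0 = N0 \/ N0 = M0.+2).
- by apply: openI => //; exact: interval_open.
- have /nbhs_ballP[e /= e0 aJ] := open_nbhs_nbhs (conj oJ Ja).
  exists (a + e / 2); split; last by rewrite /= in_itv/=; lra.
  by apply: aJ; rewrite /ball/= ltr_norml; lra.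
- by move=> b [/J01].
- by move=> b [/JMN].
- have [M0 [N0 [[_ _ mMN] _ hi]]] := typical_matching tb.
  exists M0, N0; split; first by apply: hi; move: b12; rewrite /= in_itv/= andbT.
  by have [] := nbhs_singleton mMN.
by rewrite /matching_index; case: MN0 => M0E; rewrite M0E in eqMN; [left|right]; lia.
Qed.

Theorem theorem1p4 (R : realType) :
  [/\ (@lebesgue_measure R) (`[0, 1] `\` @matching_set R) = 0%E,
      forall (M N : nat) (J : set R), matching_interval M N J ->
        [\/ matching_index M N = - 2, matching_index M N = 0
          | matching_index M N = 2],
      forall (M N : nat) (J : set R) (alpha : R),
        matching_interval M N J -> J alpha -> alpha <= 1 / 2 ->
        matching_index M N = 0 \/ matching_index M N = 2
    & forall (M N : nat) (J : set R) (alpha : R),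
        matching_interval M N J -> J alpha -> 1 / 2 <= alpha ->
        matching_index M N = 0 \/ matching_index M N = - 2].
Proof.
split; [|move=> M N J mJ|exact: matching_index_low|exact: matching_index_high].
  apply/negligibleP.
    by apply: measurableD => //; apply: open_measurable; exact: matching_set_open.
  apply: negligibleS (atypical_negligible R) => a [a01 nmatch].
  split; first by move: a01; rewrite /= in_itv.
  move=> ta; apply: nmatch; have [M [N [mMN _ _]]] := typical_matching ta.
  have [a01' _ _ _ _] := ta.
  exact: matching_on_matching_set (matching_on_local a01' mMN).
have [[[[a Ja] _ _ _] _] _] := mJ; have [a12|/ltW a12] := leP a (1 / 2).
  by case: (matching_index_low mJ Ja a12) => ->; [constructor 2|constructor 3].
by case: (matching_index_high mJ Ja a12) => ->; [constructor 2|constructor 1].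
Qed.
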